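(* Let $E$ be a Dedekind complete Riesz space with conditional expectation operator $T$, weak order unit $e$ with $Te=e$, and a filtration $(T_i)_{i\in\mathbb{Z}}$ compatible with $T$. Let $(f_i)_{i\in\mathbb{N}}\subset E$ be such that $(f_i,T_i)$ is a mixingale compatible with $T$, with sequences $(c_i)\subset E_+$ and $(\Phi_m)\subset\mathbb{R}_+$ as in the mixingale definition, and suppose the family $(f_i)$ is $T$-uniform. Write $\overline{f}_n=\frac1n\sum_{i=1}^nf_i$. (a) If the sequence $\big(\frac1n\sum_{i=1}^nc_i\big)_{n\in\mathbb{N}}$ is order bounded in $E$, then $T|\overline{f}_n|\to0$ (in order) as $n\to\infty$. (b) If $c_i=T|f_i|$ for each $i\ge1$, then $T|\overline{f}_n|\to0$ (in order) as $n\to\infty$.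
   Context: A conditional expectation operator on a Dedekind complete Riesz space $E$ with a weak order unit is a positive, order continuous linear projection $T:E\to E$ which maps weak order units to weak order units and whose range $\mathcal{R}(T)$ is a Dedekind complete Riesz subspace of $E$. A filtration is a sequence $(T_i)$ of conditional expectations with $T_iT_j=T_i=T_jT_i$ for $i\le j$; it is compatible with $T$ if $T_iT=T=TT_i$ for all $i$. $(f_i,T_i)_{i\in\mathbb{N}}$ is a mixingale compatible with $T$ if there are $(c_i)_{i\in\mathbb{N}}\subset E_+$ and $(\Phi_m)_{m\in\mathbb{N}}\subset\mathbb{R}_+$ with $\Phi_m\to0$ such that for all $i,m\in\mathbb{N}$: (i) $T|T_{i-m}f_i|\le \Phi_m c_i$, (ii) $T|f_i-T_{i+m}f_i|\le \Phi_{m+1}c_i$. For $u\in E$, $P_u$ denotes the band projection onto the band generated by $u$. A family $(f_i)$ is $T$-uniform if $\sup\{T P_{(|f_i|-ce)^+}|f_i| : i\}$ (exists for all sufficiently large $c$ and) order converges to $0$ as $c\to\infty$. *)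

(* Defs.v *)
From mathcomp Require Import all_boot all_order all_algebra.
From mathcomp Require Import reals.
Set Implicit Arguments. Unset Strict Implicit. Unset Printing Implicit Defensive.
Import Order.TTheory GRing.Theory Num.Theory.
Local Open Scope ring_scope.

Section Riesz.
Variable R : realType.
Variable E : lmodType R.

Record riesz := Riesz {
  rle : E -> E -> Prop;
  rsup : E -> E -> E;
  rle_refl : forall x, rle x x;
  rle_trans : forall x y z, rle x y -> rle y z -> rle x z;
  rle_anti : forall x y, rle x y -> rle y x -> x = y;
  rle_add : forall x y z, rle x y -> rle (x + z) (y + z);
  rle_scale : forall (a : R) x y, 0 <= a -> rle x y -> rle (a *: x) (a *: y);
  rsup_ubl : forall x y, rle x (rsup x y);
  rsup_ubr : forall x y, rle y (rsup x y);
  rsup_least : forall x y z, rle x z -> rle y z -> rle (rsup x y) z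
}.

Variable L : riesz.
Local Notation "x <=: y" := (rle L x y) (at level 70).

Definition rinf (x y : E) : E := - rsup L (- x) (- y).
Definition rabs (x : E) : E := rsup L x (- x).
Definition rpos (x : E) : E := rsup L x 0.

Definition is_ub (S : E -> Prop) (u : E) := forall x, S x -> x <=: u.
Definition is_lb (S : E -> Prop) (u : E) := forall x, S x -> u <=: x.
Definition is_sup (S : E -> Prop) (s : E) :=
  is_ub S s /\ forall u, is_ub S u -> s <=: u.
Definition is_inf (S : E -> Prop) (s : E) :=
  is_lb S s /\ forall u, is_lb S u -> u <=: s.

Definition dedekind_complete :=
  forall S : E -> Prop, (exists x, S x) -> (exists u, is_ub S u) ->
  exists s, is_sup S s.

Definition rdisjoint (x y : E) := rinf (rabs x) (rabs y) = 0.

Definition band (B : E -> Prop) :=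
  [/\ B 0,
      (forall x y, B x -> B y -> B (x + y)),
      (forall (a : R) x, B x -> B (a *: x)),
      (forall x y, rabs x <=: rabs y -> B y -> B x) &
      (forall (S : E -> Prop) s, (forall x, S x -> B x) -> is_sup S s -> B s)].

Definition band_gen (u : E) (x : E) :=
  forall B, band B -> B u -> B x.

(* y = P_u x : y lies in the band generated by u and x - y is disjoint
   from that band (Riesz decomposition). *)
Definition bandproj (u x y : E) :=
  band_gen u y /\ forall z, band_gen u z -> rdisjoint (x - y) z.

Definition weak_unit (e : E) := 0 <=: e /\ forall x, band_gen e x.

Definition is_linear (T : E -> E) :=
  forall (a : R) x y, T (a *: x + y) = a *: T x + T y.

Definition positive_op (T : E -> E) := forall x, 0 <=: x -> 0 <=: T x.

(* Order continuity (for a positive operator): x_a decreasing to 0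
   implies T x_a decreasing to 0, phrased with downward directed sets. *)
Definition order_continuous (T : E -> E) :=
  forall D : E -> Prop, (exists x, D x) ->
    (forall x y, D x -> D y -> exists z, D z /\ z <=: x /\ z <=: y) ->
    is_inf D 0 -> is_inf (fun y => exists2 x, D x & y = T x) 0.

Definition in_range (T : E -> E) (y : E) := exists x, y = T x.

Definition range_dc_riesz_subspace (T : E -> E) :=
  (forall x y, in_range T (rsup L (T x) (T y))) /\
  (forall S : E -> Prop, (forall x, S x -> in_range T x) -> (exists x, S x) ->
     (exists2 u, in_range T u & is_ub S u) ->
     exists s, [/\ in_range T s, is_ub S s &
        forall u, in_range T u -> is_ub S u -> s <=: u]).

Definition cond_exp (T : E -> E) :=
  [/\ positive_op T, order_continuous T, is_linear T,
      (forall x, T (T x) = T x) &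
      (forall w, weak_unit w -> weak_unit (T w))] /\
  range_dc_riesz_subspace T.

Definition filtration (TT : int -> E -> E) :=
  (forall i, cond_exp (TT i)) /\
  (forall i j, (i <= j)%R -> forall x, TT i (TT j x) = TT i x /\ TT j (TT i x) = TT i x).

Definition compatible (T : E -> E) (TT : int -> E -> E) :=
  forall i x, TT i (T x) = T x /\ T (TT i x) = T x.

Definition mixingale_with (T : E -> E) (TT : int -> E -> E) (f : nat -> E)
    (c : nat -> E) (Phi : nat -> R) :=
  [/\ (forall i, (1 <= i)%N -> 0 <=: c i),
      (forall m, (1 <= m)%N -> 0 <= Phi m),
      (forall eps : R, 0 < eps -> exists N, forall m, (N <= m)%N -> `|Phi m| < eps),
      (forall i m, (1 <= i)%N -> (1 <= m)%N ->
          T (rabs (TT (Posz i - Posz m) (f i))) <=: Phi m *: c i) &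
      (forall i m, (1 <= i)%N -> (1 <= m)%N ->
          T (rabs (f i - TT (Posz i + Posz m) (f i))) <=: Phi m.+1 *: c i)].

Definition oconv (s : nat -> E) (x : E) :=
  exists p : nat -> E,
    [/\ (forall n m, (n <= m)%N -> p m <=: p n),
        is_inf (fun y => exists n, y = p n) 0 &
        forall n, rabs (s n - x) <=: p n].

Definition oconv_inf (g : R -> E) (x : E) :=
  exists (c1 : R) (p : R -> E),
    [/\ (forall c c', c1 <= c -> c <= c' -> p c' <=: p c),
        is_inf (fun y => exists2 c, c1 <= c & y = p c) 0 &
        forall c, c1 <= c -> rabs (g c - x) <=: p c].

Definition tuniform (T : E -> E) (e : E) (f : nat -> E) :=
  exists (c0 : R) (g : R -> E),
    (forall c, c0 <= c ->
       is_sup (fun y => exists i, (1 <= i)%N /\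
                 exists z, bandproj (rpos (rabs (f i) - c *: e)) (rabs (f i)) z
                           /\ y = T z) (g c)) /\
    oconv_inf g 0.

Definition avg (f : nat -> E) (n : nat) : E :=
  (n%:R)^-1 *: \sum_(1 <= i < n.+1) f i.

Definition order_bounded_seq (s : nat -> E) :=
  exists a b, forall n, (1 <= n)%N -> a <=: s n /\ s n <=: b.

End Riesz.

(* Main.v *)
(* Truncate [f = h + r] with [|h| <= B e] and [T |r|] small by uniformity, and
   telescope [f_i] along the filtration from time [i - m] to time [i + m]: the
   two ends are controlled by the mixingale bounds, and there remain [2 m]
   martingale difference sequences, which are bounded up to small errors.  For
   bounded martingale differences the L2 argument would need a product on [E].
   It is replaced by the piecewise linear potential
   [phi x = \sum_(k < K) |x - 2 B k e|].  Adding an increment [|d| <= B e] of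
   conditional mean zero raises each summand by at most twice a tent of height
   [B] around its kink; the tents are disjoint, so [T (phi S_n)] grows by at
   most [2 B e] per step, while [phi x >= K |x| - C_K e].  Hence
   [T |S_n| / n <= (2 C_K / (n K) + 2 B / K) e], which is small for [K] large
   and then [n] large. *)
Require Import Defs.
From mathcomp Require Import all_boot all_order all_algebra.
From mathcomp Require Import reals boolp.
From mathcomp Require Import ring lra zify.
Import Order.TTheory GRing.Theory Num.Theory.
Local Open Scope ring_scope.

(** * Linear identities in modules *)

Section LinearReflection.
Variables (R : comPzRingType) (E : lmodType R).

(** Syntax for linear combinations of atoms: two of them agree in every module as soon as their
    coefficients agree atom by atom, which is a question about scalars only. *)
Inductive lexp :=
  | LAtom of nat | LZero | LAdd of lexp & lexp | LOpp of lexp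
  | LScale of R & lexp.

Fixpoint leval (env : seq E) (t : lexp) : E :=
  match t with
  | LAtom i => nth 0 env i
  | LZero => 0
  | LAdd a b => leval env a + leval env b
  | LOpp a => - leval env a
  | LScale r a => r *: leval env a
  end.

Fixpoint lcoef (t : lexp) (i : nat) : R :=
  match t with
  | LAtom j => if Nat.eqb j i then 1 else 0
  | LZero => 0
  | LAdd a b => lcoef a i + lcoef b i
  | LOpp a => - lcoef a i
  | LScale r a => r * lcoef a i
  end.

Fixpoint lcoef_eq (k : nat) (a b : lexp) : Prop :=
  match k with
  | 0 => True
  | S k => lcoef a k = lcoef b k /\ lcoef_eq k a b
  end.

Lemma levalE (env : seq E) (t : lexp) :
  leval env t = \sum_(i < size env) lcoef t i *: nth 0 env i.
Proof.
elim: t => [j||a IHa b IHb|a IHa|r a IHa] /=.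
- case: (ltnP j (size env)) => [lt_j|le_j]; last first.
    rewrite nth_default // big1 // => i _.
    case: PeanoNat.Nat.eqb_spec => [eq_j|_]; last by rewrite scale0r.
    by move: (ltn_ord i); rewrite -eq_j ltnNge le_j.
  rewrite (bigD1 (Ordinal lt_j)) //= PeanoNat.Nat.eqb_refl scale1r.
  rewrite big1 ?addr0 // => i /eqP ne_ij.
  case: PeanoNat.Nat.eqb_spec => [eq_j|_]; last by rewrite scale0r.
  by case: ne_ij; apply: val_inj.
- by rewrite big1 // => i _; rewrite scale0r.
- by rewrite IHa IHb -big_split; apply: eq_bigr => i _; rewrite scalerDl.
- by rewrite IHa -sumrN; apply: eq_bigr => i _; rewrite scaleNr.
- by rewrite IHa scaler_sumr; apply: eq_bigr => i _; rewrite scalerA.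
Qed.

Lemma leval_eq (env : seq E) (a b : lexp) :
  lcoef_eq (size env) a b -> leval env a = leval env b.
Proof.
move=> ab; rewrite !levalE; apply: eq_bigr => -[i /= lt_i] _; congr (_ *: _).
elim: (size env) lt_i ab => //= k IH; rewrite ltnS leq_eqVlt.
by case/orP=> [/eqP -> []|lt_i [_ /(IH lt_i)]].
Qed.

End LinearReflection.

(* Atoms are compared up to conversion, since the same sum can be elaborated
   through different structures. *)
Ltac vec_mem x l :=
  match l with
  | nil => constr:(false)
  | cons ?y _ => let _ := match goal with _ => unify x y end in constr:(true)
  | cons _ ?l' => vec_mem x l'
  end.

Ltac vec_atoms t l :=
  lazymatch t with
  | GRing.zero => l
  | GRing.add ?a ?b => let l' := vec_atoms a l in vec_atoms b l'
  | GRing.opp ?a => vec_atoms a l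
  | GRing.scale _ ?a => vec_atoms a l
  | _ => lazymatch vec_mem t l with
         | true => l
         | false => constr:(cons t l)
         end
  end.

Ltac vec_index x l :=
  match l with
  | cons ?y _ => let _ := match goal with _ => unify x y end in constr:(O)
  | cons _ ?l' => let n := vec_index x l' in constr:(S n)
  end.

Ltac vec_reify R t l :=
  lazymatch t with
  | GRing.zero => constr:(LZero R)
  | GRing.add ?a ?b =>
      let a' := vec_reify R a l in let b' := vec_reify R b l in
      constr:(LAdd R a' b')
  | GRing.opp ?a => let a' := vec_reify R a l in constr:(LOpp R a')
  | GRing.scale ?r ?a => let a' := vec_reify R a l in constr:(LScale R r a')
  | _ => let n := vec_index t l in constr:(LAtom R n)
  end.

(** Reifies both sides over a common list of atoms and leaves one scalar identity per atom to [ring]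
    or [field]. *)
Ltac vec R :=
  lazymatch goal with
  | |- @eq ?T ?x ?y =>
    let l := vec_atoms x (@nil T) in
    let l := vec_atoms y l in
    let a := vec_reify R x l in
    let b := vec_reify R y l in
    apply: (@leval_eq R _ l a b);
    cbn [size lcoef_eq lcoef Nat.eqb]; repeat split; try ring;
    try by field; do ?[apply/andP; split]
  end.

(** * Riesz spaces *)

Section RieszSpace.
Context {R : realType} {E : lmodType R} (L : riesz E).
Local Notation "x <=: y" := (rle L x y) (at level 70).
Local Notation abs := (rabs L).
Local Notation pos := (rpos L).

Implicit Types (x y z w u : E) (a b : R).

Lemma rle_subr_ge0 {x y} : x <=: y <-> 0 <=: y - x.
Proof.
split=> [xy|xy].
  by have := rle_add (- x) xy; rewrite subrr.
by have := rle_add x xy; rewrite add0r subrK.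
Qed.

(** This lemma and its variants certify an inequality by writing [y - x] as a nonnegative
    combination of known differences; the certificate is a linear identity, left to [vec]. *)
Lemma rle_lin1 {a p q x y} : 0 <= a -> p <=: q ->
  y - x = a *: (q - p) -> x <=: y.
Proof.
move=> a0 /rle_subr_ge0 pq yx; apply/rle_subr_ge0; rewrite yx.
by have := rle_scale a0 pq; rewrite scaler0.
Qed.

Lemma rleD {x y z w} : x <=: y -> z <=: w -> x + z <=: y + w.
Proof.
move=> xy zw; apply: rle_trans (rle_add z xy) _.
by rewrite ![y + _]addrC; apply: rle_add.
Qed.

Lemma rle_lin2 {a b p q r s x y} : 0 <= a -> 0 <= b -> p <=: q -> r <=: s ->
  y - x = a *: (q - p) + b *: (s - r) -> x <=: y.
Proof.
move=> a0 b0 pq rs yx; apply/rle_subr_ge0; rewrite yx -[0]addr0.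
by apply: rleD; [move: (rle_scale a0 (rle_subr_ge0.1 pq))
  | move: (rle_scale b0 (rle_subr_ge0.1 rs))]; rewrite scaler0.
Qed.

Lemma rle1 {p q x y} : p <=: q -> y - x = q - p -> x <=: y.
Proof. by move=> pq yx; apply: (rle_lin1 ler01 pq); rewrite scale1r. Qed.

Lemma rle2 {p q r s x y} : p <=: q -> r <=: s ->
  y - x = (q - p) + (s - r) -> x <=: y.
Proof.
by move=> pq rs yx; apply: (rle_lin2 ler01 ler01 pq rs); rewrite !scale1r.
Qed.

Lemma rle_scalel {a b x} : 0 <=: x -> a <= b -> a *: x <=: b *: x.
Proof.
move=> x0 ab; have ba0 : 0 <= b - a by rewrite subr_ge0.
by apply: (rle_lin1 ba0 x0); vec R.
Qed.

Lemma rle_sum (I : Type) (s : seq I) (P : pred I) (F G : I -> E) :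
  (forall i, P i -> F i <=: G i) ->
  \sum_(i <- s | P i) F i <=: \sum_(i <- s | P i) G i.
Proof.
move=> FG; elim/big_ind2 : _ => // *; first exact: rle_refl.
exact: rleD.
Qed.

Lemma rpos_ge x : x <=: pos x. Proof. exact: rsup_ubl. Qed.
Lemma rpos_ge0 x : 0 <=: pos x. Proof. exact: rsup_ubr. Qed.
Lemma rpos_least {x z} : x <=: z -> 0 <=: z -> pos x <=: z.
Proof. exact: rsup_least. Qed.
Lemma rpos_mono {x y} : x <=: y -> pos x <=: pos y.
Proof.
by move=> xy; apply: rpos_least (rpos_ge0 _); apply: rle_trans xy (rpos_ge _).
Qed.

Lemma rabs_ge x : x <=: abs x. Proof. exact: rsup_ubl. Qed.
Lemma rabs_geN x : - x <=: abs x. Proof. exact: rsup_ubr. Qed.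
Lemma rabs_least {x z} : x <=: z -> - x <=: z -> abs x <=: z.
Proof. exact: rsup_least. Qed.

Lemma rabs_ge0 x : 0 <=: abs x.
Proof.
have h0 : 0 <= 2^-1 :> R by rewrite invr_ge0.
by apply: (rle_lin2 h0 h0 (rabs_ge x) (rabs_geN x)); vec R.
Qed.

Lemma rabs_id {x} : 0 <=: x -> abs x = x.
Proof.
move=> x0; apply: rle_anti (rabs_ge _); apply: rabs_least (rle_refl _ _) _.
by apply: (rle2 x0 x0); vec R.
Qed.

Lemma rabsN x : abs (- x) = abs x.
Proof.
have le y : abs (- y) <=: abs y.
  by apply: rabs_least; [exact: rabs_geN | rewrite opprK; exact: rabs_ge].
by apply: rle_anti (le x) _; have := le (- x); rewrite opprK.
Qed.

Lemma rabsD x y : abs (x + y) <=: abs x + abs y.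
Proof.
apply: rabs_least; first exact: rleD (rabs_ge _) (rabs_ge _).
by rewrite opprD; exact: rleD (rabs_geN _) (rabs_geN _).
Qed.

Lemma rabs_sum (I : Type) (s : seq I) (P : pred I) (F : I -> E) :
  abs (\sum_(i <- s | P i) F i) <=: \sum_(i <- s | P i) abs (F i).
Proof.
elim/big_ind2 : _ => [|x y z w xy zw|i _]; last exact: rle_refl.
  by rewrite rabs_id; exact: rle_refl.
by apply: rle_trans (rabsD _ _) _; apply: rleD.
Qed.

Lemma rabsZ {a x} : 0 <= a -> abs (a *: x) <=: a *: abs x.
Proof.
move=> a0; apply: rabs_least; first exact: rle_scale (rabs_ge _).
by rewrite -scalerN; exact: rle_scale (rabs_geN _).
Qed.

(* Case analysis on the sign of [w]: an inequality may be proved up to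
   multiples of the negative part, then of the positive part, of [w], as
   these are disjoint. *)
Lemma rle_cases {a} w x y : 0 < a ->
  x <=: y + a *: pos (- w) -> x <=: y + a *: pos w -> x <=: y.
Proof.
move=> a0 xn xp; have ai0 : 0 <= a^-1 by rewrite invr_ge0 ltW.
have an0 : a != 0 by rewrite gt_eqF.
(* [v] lies below both [pos w] and [pos (- w)], which is at most [pos w - w]. So both [w] and [0]
   are at most [pos w - v], hence so is [pos w], and [v] is at most [0]. *)
set v := a^-1 *: (x - y).
have vp : v <=: pos w by apply: (rle_lin1 ai0 xp); rewrite /v; vec R.
have vn : v <=: pos (- w) by apply: (rle_lin1 ai0 xn); rewrite /v; vec R.
have pwE : pos (- w) <=: pos w - w.
  apply: rpos_least; first by apply: (rle1 (rpos_ge0 w)); vec R.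
  by apply: (rle1 (rpos_ge w)); vec R.
have vw : v + w <=: pos w by apply: (rle2 vn pwE); vec R.
have pwv : pos w <=: pos w - v.
  apply: rpos_least; first by apply: (rle1 vw); vec R.
  by apply: (rle1 vp); vec R.
by apply: (rle_lin1 (ltW a0) pwv); rewrite /v; vec R.
Qed.

(** * Positive linear operators *)

Section Positive.
Context {F : E -> E} (Fp : positive_op L F) (Fl : is_linear F).

Lemma linD x y : F (x + y) = F x + F y.
Proof. by have := Fl 1 x y; rewrite !scale1r. Qed.
Lemma lin0 : F 0 = 0.
Proof. by apply: (addIr (F 0)); rewrite -linD !add0r. Qed.
Lemma linZ a x : F (a *: x) = a *: F x.
Proof. by have := Fl a x 0; rewrite lin0 !addr0. Qed.
Lemma linN x : F (- x) = - F x.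
Proof. by rewrite -scaleN1r linZ scaleN1r. Qed.
Lemma linB x y : F (x - y) = F x - F y.
Proof. by rewrite linD linN. Qed.
Lemma lin_sum (I : Type) (s : seq I) (P : pred I) (G : I -> E) :
  F (\sum_(i <- s | P i) G i) = \sum_(i <- s | P i) F (G i).
Proof. exact: (big_morph F linD lin0). Qed.

Lemma pos_mono x y : x <=: y -> F x <=: F y.
Proof.
by move=> xy; apply/rle_subr_ge0; rewrite -linB; exact: Fp (rle_subr_ge0.1 xy).
Qed.

Lemma pos_rabs x : abs (F x) <=: F (abs x).
Proof.
apply: rabs_least; first exact: pos_mono (rabs_ge _).
by rewrite -linN; exact: pos_mono (rabs_geN _).
Qed.

End Positive.

(** * Bounded martingale differences *)

Section Tents.
Context {B : R} {e : E} (B0 : 0 <= B) (e0 : 0 <=: e).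

Let tent (y : E) : E := pos (B *: e - abs y).

Lemma tent_le (y : E) : tent y <=: B *: e.
Proof.
apply: rpos_least; first by apply: (rle1 (rabs_ge0 y)); vec R.
by have := rle_scalel e0 B0; rewrite scale0r.
Qed.

(* The tents of height [B] centred at [2 B k] are pairwise disjoint.  The
   second bound says that the first [K] of them live below [(2 K - 1) B]. *)
Lemma tent_sum (K : nat) (y : E) :
  let s := \sum_(k < K) tent (y - (2 * B * k%:R) *: e) in
  s <=: B *: e /\ s <=: K%:R *: pos ((2 * K%:R - 1) * B *: e - y).
Proof.
move=> s; rewrite {}/s; elim: K => [|K [IH1 IH2]].
  rewrite big_ord0 scale0r; split; last exact: rle_refl.
  by have := rle_scalel e0 B0; rewrite scale0r.
rewrite big_ord_recr /=.
set s := \sum_(k < K) _ in IH1 IH2 *; set a := 2 * B * K%:R.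
(* The sign of [w] separates the new tent from the old ones: [t] is at most [pos (- w)], and the sum
   of the first [K] is at most [K] times [pos w]. *)
set t := tent _; set w := (2 * K%:R - 1) * B *: e - y in IH2 *.
have tB : t <=: B *: e by exact: tent_le.
have K0 : 0 <= K%:R :> R by [].
have tw : t <=: pos (- w).
  apply: rpos_mono; apply: (rle1 (rabs_geN (y - a *: e))).
  by rewrite /w /a; vec R.
have tw' : t <=: pos ((2 * K.+1%:R - 1) * B *: e - y).
  apply: rpos_mono; apply: (rle1 (rabs_ge (y - a *: e))).
  by rewrite /a -natr1; vec R.
split.
(* [K + 1] dominates both multipliers, [1] and [K], and is positive even for [K = 0]. *)
- apply: (@rle_cases K.+1%:R w); first by rewrite ltr0n.
    apply: rle_trans (_ : B *: e + 1 *: pos (- w) <=: _).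
      by apply: (rle2 IH1 tw); vec R.
    by apply: rleD (rle_refl _ _) (rle_scalel (rpos_ge0 _) _); rewrite ler1n.
  apply: rle_trans (_ : B *: e + K%:R *: pos w <=: _).
    by apply: (rle2 IH2 tB); rewrite -/w; vec R.
  by apply: rleD (rle_refl _ _) (rle_scalel (rpos_ge0 _) _); rewrite ler_nat.
- have ww : pos w <=: pos ((2 * K.+1%:R - 1) * B *: e - y).
    have B20 : 0 <= 2 * B by rewrite mulr_ge0.
    by apply: rpos_mono; apply: (rle_lin1 B20 e0); rewrite /w -natr1; vec R.
  have IH3 := rle_trans IH2 (rle_scale K0 ww).
  by apply: (rle2 IH3 tw'); rewrite -natr1; vec R.
Qed.

End Tents.

(** Fixed points of [F] play the role of measurable functions; the last clause makes them a
    sublattice, so that positive parts of fixed points are fixed. *)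
Definition averaging (e : E) (F : E -> E) :=
  [/\ positive_op L F, is_linear F, F e = e &
      forall x y, F x = x -> F y = y -> F (rsup L x y) = rsup L x y].

(* The convexity estimate replacing [(Y + d)^2 <= Y^2 + 2 Y d + B^2]: moving
   [Y] by an increment of conditional mean zero increases [|Y|] only where
   [|Y| < B]. *)
Lemma averaging_step {F e} {B : R} {Y d} : 0 <= B -> 0 <=: e ->
  averaging e F -> F Y = Y -> F d = 0 -> abs d <=: B *: e ->
  F (abs (Y + d)) <=: abs Y + 2 *: pos (B *: e - abs Y).
Proof.
move=> B0 e0 [Fp Fl Fe Fs] FY Fd dB.
have FBe : F (B *: e) = B *: e by rewrite (linZ Fl) Fe.
have F0 : F 0 = 0 by exact: lin0.
have two0 : 0 <= 2 :> R by [].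
(* Since [d] is at least [- B e], [|Y + d|] is at most [Y + d + 2 (B e - Y)^+], and [F] removes only
   [d] from the right side. The symmetric bound comes from [- Y] and [- d]. *)
have key : forall Y d, F Y = Y -> F d = 0 -> abs d <=: B *: e ->
    F (abs (Y + d)) <=: Y + 2 *: pos (B *: e - Y).
  move=> {FY Fd dB d} {}Y d FY Fd dB.
  set p := pos _; have Fpp : F p = p.
    by apply: Fs => //; rewrite (linB Fl) FBe FY.
  have -> : Y + 2 *: p = F (Y + d + 2 *: p).
    by rewrite !(linD Fl) (linZ Fl) Fpp FY Fd addr0.
  have db := rle_trans (rabs_geN d) dB.
  apply: pos_mono => //; apply: rabs_least.
    by apply: (rle_lin1 two0 (rpos_ge0 (B *: e - Y))); rewrite -/p; vec R.
  by apply: (rle_lin2 two0 two0 (rpos_ge (B *: e - Y)) db); rewrite -/p; vec R.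
have kp := key _ _ FY Fd dB.
have kn : F (abs (Y + d)) <=: - Y + 2 *: pos (B *: e + Y).
  have := key (- Y) (- d); rewrite -opprD (rabsN (Y + d)) opprK; apply.
  - by rewrite (linN Fl) FY.
  - by rewrite (linN Fl) Fd oppr0.
  - by rewrite rabsN.
have absP : forall Z, abs Z <=: Z + 2 *: pos (- Z).
  move=> Z; apply: rabs_least.
    by apply: (rle_lin1 two0 (rpos_ge0 (- Z))); vec R.
  by apply: (rle_lin1 two0 (rpos_ge (- Z))); vec R.
(* Passing from [Z] to [|Z|] costs a multiple of the negative part of [Z], which [rle_cases]
   discards on the sign of [Y]. *)
have part : forall Z, abs Z = abs Y ->
    Z + 2 *: pos (B *: e - Z) <=:
    abs Y + 2 *: pos (B *: e - abs Y) + 4 *: pos (- Z).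
  move=> Z ZY; rewrite -ZY.
  have h : pos (B *: e - Z) <=: pos (B *: e - abs Z) + 2 *: pos (- Z).
    apply: rpos_least.
      by apply: (rle2 (rpos_ge (B *: e - abs Z)) (absP Z)); vec R.
    have := rleD (rpos_ge0 (B *: e - abs Z)) (rle_scale two0 (rpos_ge0 (- Z))).
    by rewrite scaler0 addr0.
  by apply: (rle_lin2 two0 ler01 h (rabs_ge Z)); vec R.
apply: (@rle_cases 4 Y) => //; first exact: rle_trans kp (part Y erefl).
by have := part (- Y) (rabsN Y); rewrite !opprK; exact: rle_trans.
Qed.

(** The potential starts at [C e] and its [T]-mean gains at most [2 B e] per step, because [T]
    absorbs each [F m]. Returning from the potential to [K |S n|] costs [C e] once more. *)
Lemma martingale_bound {T : E -> E} {F : nat -> E -> E} {e : E} {B : R}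
    {d : nat -> E} (K n : nat) :
  let S n := \sum_(1 <= i < n.+1) d i in
  0 <= B -> 0 <=: e -> averaging e T -> (forall n, averaging e (F n)) ->
  (forall n x, T (F n x) = T x) ->
  (forall n, F n (S n) = S n) -> (forall n, F n (d n.+1) = 0) ->
  (forall n, abs (d n.+1) <=: B *: e) ->
  K%:R *: T (abs (S n)) <=:
    (2 * (\sum_(k < K) 2 * B * k%:R) + 2 * n%:R * B) *: e.
Proof.
move=> S B0 e0 [Tp Tl Te _] Fa TF FS Fd dB.
set C := \sum_(k < K) _; pose a k : R := 2 * B * k%:R.
pose phi x := \sum_(k < K) abs (x - a k *: e).
have a0 k : 0 <= a k by rewrite /a !mulr_ge0.
have ae0 k : 0 <=: a k *: e by have := rle_scalel e0 (a0 k); rewrite scale0r.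
have phi0 : phi 0 = C *: e.
  rewrite /C scaler_suml; apply: eq_bigr => k _.
  by rewrite sub0r rabsN rabs_id.
have phi_ge x : K%:R *: abs x <=: phi x + C *: e.
  have -> : K%:R *: abs x = \sum_(k < K) abs x.
    by rewrite sumr_const card_ord scaler_nat.
  rewrite /C scaler_suml -big_split; apply: rle_sum => k _ /=.
  rewrite -{1}(subrK (a k *: e) x); apply: rle_trans (rabsD _ _) _.
  by rewrite (rabs_id (ae0 k)); exact: rle_refl.
have phiS m : F m (phi (S m.+1)) <=: phi (S m) + (2 * B) *: e.
  have [Fp Fl Fe _] := Fa m.
  pose tents := \sum_(k < K) pos (B *: e - abs (S m - a k *: e)).
  have tB : tents <=: B *: e by case: (tent_sum B0 e0 K (S m)).
  apply: rle_trans (_ : phi (S m) + 2 *: tents <=: _).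
    rewrite (lin_sum Fl) scaler_sumr -big_split; apply: rle_sum => k _ /=.
    have -> : S m.+1 - a k *: e = S m - a k *: e + d m.+1.
      by rewrite /S big_nat_recr //= addrAC.
    apply: averaging_step => //.
    by rewrite (linB Fl) FS (linZ Fl) Fe.
  have h2 : 0 <= 2 :> R by [].
  by apply: (rle_lin1 h2 tB); vec R.
have Tphi : T (phi (S n)) <=: (C + 2 * n%:R * B) *: e.
  elim: n => [|n IHn].
    rewrite /S big_geq // phi0 (linZ Tl) Te mulr0 mul0r addr0.
    exact: rle_refl.
  rewrite -(TF n (phi _)); apply: rle_trans (pos_mono Tp Tl _ _ (phiS n)) _.
  rewrite (linD Tl) (linZ Tl) Te.
  by apply: (rle1 IHn); rewrite -natr1; vec R.
have := pos_mono Tp Tl _ _ (phi_ge (S n)); rewrite (linZ Tl) => h.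
apply: rle_trans h _; rewrite (linD Tl) (linZ Tl) Te.
by apply: (rle1 Tphi); vec R.
Qed.

(** * Bands and order limits *)

Lemma rinf_lel x y : rinf L x y <=: x.
Proof. by apply: (rle1 (rsup_ubl L (- x) (- y))); rewrite /rinf; vec R. Qed.

Lemma rinf_ler x y : rinf L x y <=: y.
Proof. by apply: (rle1 (rsup_ubr L (- x) (- y))); rewrite /rinf; vec R. Qed.

Lemma rle_opp {x y} : x <=: y -> - y <=: - x.
Proof. by move=> xy; apply: (rle1 xy); vec R. Qed.

Lemma rinf_greatest {x y z} : z <=: x -> z <=: y -> z <=: rinf L x y.
Proof.
move=> /rle_opp zx /rle_opp zy.
by apply: (rle1 (rsup_least zx zy)); rewrite /rinf; vec R.
Qed.

Lemma rdisjointP {x y} :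
  rdisjoint L x y <-> forall w, w <=: abs x -> w <=: abs y -> w <=: 0.
Proof.
split=> [xy w wx wy|xy].
  by move: (rinf_greatest wx wy); rewrite xy.
apply: rle_anti; first by apply: xy; [exact: rinf_lel | exact: rinf_ler].
exact: rinf_greatest (rabs_ge0 _) (rabs_ge0 _).
Qed.

(** Makes disjointness from a generator [u] enough for disjointness from all of [band_gen u]. *)
Lemma rdisjoint_band y : band L (rdisjoint L y).
Proof.
split.
- apply/rdisjointP => w _; rewrite rabs_id //; exact: rle_refl.
- move=> x z /rdisjointP yx /rdisjointP yz; apply/rdisjointP => w wy wxz.
  apply: yz => //.
  have : w - abs z <=: 0.
    apply: yx; last by apply: (rle2 wxz (rabsD x z)); vec R.
    by apply: (rle2 wy (rabs_ge0 z)); vec R.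
  by move=> h; apply: (rle1 h); vec R.
- move=> a x /rdisjointP yx; apply/rdisjointP => w wy wax.
  (* As [c] is at least both [|a|] and [1], dividing [pos w] by [c] brings it below [|x|] and keeps
     it below [|y|]. *)
  apply: rle_trans (rpos_ge w) _; set c := `|a| + 1.
  have c1 : 1 <= c by rewrite lerDr.
  have c0 : 0 < c := lt_le_trans ltr01 c1.
  have ci0 : 0 <= c^-1 by rewrite invr_ge0 ltW.
  have cn0 : c != 0 by rewrite gt_eqF.
  have xc : abs (a *: x) <=: c *: abs x.
    have ac : `|a| <= c by rewrite lerDl.
    apply: rle_trans (rle_scalel (rabs_ge0 x) ac).
    case: (ger0P a) => a0; first exact: rabsZ.
    by rewrite -(rabsN (a *: x)) -scaleNr; apply: rabsZ; rewrite oppr_ge0 ltW.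
  have pc : pos w <=: c *: abs x.
    apply: rpos_least (rle_trans wax xc) _.
    by have := rle_scale (ltW c0) (rabs_ge0 x); rewrite scaler0.
  have : c^-1 *: pos w <=: 0.
    apply: yx; last by apply: (rle_lin1 ci0 pc); vec R.
    have /(rle_scalel (rpos_ge0 w)) : c^-1 <= 1 by rewrite invf_le1.
    rewrite scale1r => h; apply: rle_trans h (rpos_least wy (rabs_ge0 _)).
  by move=> h; apply: (rle_lin1 (ltW c0) h); vec R.
- move=> x z xz /rdisjointP yz; apply/rdisjointP => w wy wx.
  exact: yz wy (rle_trans wx xz).
- move=> S s Sy [ubs lubs]; apply/rdisjointP => w wy ws.
  (* A supremum of the empty set would be a least element; comparing it with [s - w] gives the
     claim. *)
  have [[x0 Sx0]|S0] := pselect (exists x, S x); last first.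
    have all_ge t : s <=: t by apply: lubs => x Sx; case: S0; exists x.
    by apply: (rle1 (all_ge (s - w))); vec R.
  (* The positive part of [s] is disjoint from [y]: for [x] in [S], disjointness gives
     [pos x + v' <= pos s], and negative parts decrease, so [s - v'] is still an upper bound of
     [S]. *)
  have disj v : v <=: abs y -> v <=: pos s -> v <=: 0.
    move=> vy vs; apply: rle_trans (rpos_ge v) _; set v' := pos v.
    have v'y : v' <=: abs y := rpos_least vy (rabs_ge0 _).
    have v's : v' <=: pos s := rpos_least vs (rpos_ge0 _).
    suff /lubs h : is_ub L S (s - v') by apply: (rle1 h); vec R.
    move=> x Sx; have xs := ubs _ Sx.
    have pxs := rpos_mono xs.
    have h : pos x + v' - pos s <=: 0.
      have /rdisjointP := Sy _ Sx; apply.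
        by apply: (rle2 pxs v'y); vec R.
      have pxx : pos x <=: abs x := rpos_least (rabs_ge x) (rabs_ge0 x).
      by apply: (rle2 v's pxx); vec R.
    have hs : pos s - s <=: pos x - x.
      suff g : pos s <=: pos x - x + s by apply: (rle1 g); vec R.
      apply: rpos_least; first by apply: (rle1 (rpos_ge x)); vec R.
      by apply: (rle2 (rpos_ge0 x) xs); vec R.
    by apply: (rle2 h hs); vec R.
  (* The negative part of [s] is dominated by [|x0|] for any member [x0], so what remains reduces to
     disjointness from [x0]. *)
  have /rdisjointP := Sy _ Sx0; apply=> //.
  have sx0 : pos (- s) <=: abs x0.
    apply: rpos_least (rabs_ge0 _).
    exact: rle_trans (rle_opp (ubs _ Sx0)) (rabs_geN _).
  have : w - pos (- s) <=: 0.
    apply: disj; first by apply: (rle2 wy (rpos_ge0 (- s))); vec R.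
    have h : abs s <=: pos s + pos (- s).
      apply: rabs_least.
        by apply: (rle2 (rpos_ge s) (rpos_ge0 (- s))); vec R.
      by apply: (rle2 (rpos_ge0 s) (rpos_ge (- s))); vec R.
    by apply: (rle2 ws h); vec R.
  by move=> h; apply: (rle2 h sx0); vec R.
Qed.

(** The projection is the supremum over [n] of the infima of [x] and [n u]; the term [n = 1] gives
    [u <=: z]. *)
Lemma bandproj_exists {u x} : dedekind_complete L -> 0 <=: u -> u <=: x ->
  exists2 z, bandproj L u x z & u <=: z.
Proof.
move=> DC u0 ux; have x0 := rle_trans u0 ux.
pose S y := exists n : nat, y = rinf L x (n%:R *: u).
have nu0 (n : nat) : 0 <=: n%:R *: u.
  by have := rle_scalel u0 (ler0n R n); rewrite scale0r.
have [|| z [ubz lubz]] := DC S.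
- by exists (rinf L x (0%:R *: u)); exists 0%N.
- by exists x => _ [n ->]; exact: rinf_lel.
have zx : z <=: x by apply: lubz => _ [n ->]; exact: rinf_lel.
have xz0 : 0 <=: x - z by apply/rle_subr_ge0.1.
exists z; last first.
  apply: rle_trans (ubz _ (ex_intro _ 1%N erefl)).
  by apply: rinf_greatest; rewrite // scale1r; exact: rle_refl.
split=> [D bD Du|v vu].
  have [_ _ DZ Dsol Dsup] := bD; apply: (Dsup S) => // _ [n ->].
  apply: (Dsol _ (n%:R *: u)); last exact: DZ.
  rewrite !rabs_id //; first exact: rinf_ler.
  exact: rinf_greatest x0 (nu0 n).
apply: vu (rdisjoint_band _) _; apply/rdisjointP => w.
rewrite !rabs_id // => wxz wu; apply: rle_trans (rpos_ge w) _.
have pwx := rpos_least wxz xz0; have pwu := rpos_least wu u0.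
(* A common lower bound of [x - z] and [u], added to the [n]-th term, stays below the next term,
   hence below [z]. *)
suff /lubz h : is_ub L S (z - pos w) by apply: (rle1 h); vec R.
move=> y Sy; have yz := ubz _ Sy; case: Sy yz => n -> yz.
set y' := rinf _ _ _ in yz *.
suff h : y' + pos w <=: z by apply: (rle1 h); vec R.
apply: rle_trans (ubz _ (ex_intro _ n.+1 erefl)); apply: rinf_greatest.
  by apply: (rle2 yz pwx); vec R.
by apply: (rle2 (rinf_ler x (n%:R *: u)) pwu); rewrite -/y' -natr1; vec R.
Qed.

(** All multiples [n u] lie below [b]; if [s] is their supremum, [s - u] is an upper bound as
    well. *)
Lemma archimedean {u b : E} : dedekind_complete L -> 0 <=: b ->
  (forall t : R, 0 < t -> u <=: t *: b) -> u <=: 0.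
Proof.
move=> DC b0 ub; pose S y := exists n : nat, y = n%:R *: u.
have [|| s [ubs lubs]] := DC S; first by exists (0%:R *: u); exists 0%N.
  exists b => _ [[|n] ->]; first by rewrite scale0r.
  have : 0 < n.+1%:R :> R by [].
  move: n.+1%:R => r r0; have rn0 : r != 0 by rewrite gt_eqF.
  have h : 0 < r^-1 by rewrite invr_gt0.
  by apply: (rle_lin1 (ltW r0) (ub _ h)); vec R.
suff /lubs h : is_ub L S (s - u) by apply: (rle1 h); vec R.
move=> _ [n ->].
have h := ubs _ (ex_intro _ n.+1 erefl).
by apply: (rle1 h); rewrite -natr1; vec R.
Qed.

(** The dominating sequence consists of the suprema of the tails. The last hypothesis, that nothing
    above [0] lies below all eventual upper bounds, replaces an epsilon argument. *)
Lemma oconv0_eventually {s : nat -> E} {b : E} : dedekind_complete L ->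
  (forall n, 0 <=: s n) -> (forall n, s n <=: b) ->
  (forall u, (forall w, (exists N, forall n, (N <= n)%N -> s n <=: w) ->
     u <=: w) -> u <=: 0) ->
  oconv L s 0.
Proof.
move=> DC s0 sb small.
have /choice[q qP] : forall n, exists y,
    is_sup L (fun y => exists2 k, (n <= k)%N & y = s k) y.
  move=> n; apply: DC; first by exists (s n); exists n.
  by exists b => _ [k _ ->].
have sq n k : (n <= k)%N -> s k <=: q n by move=> nk; apply: (qP n).1; exists k.
exists q; split=> [n m nm||n].
- by apply: (qP m).2 => _ [k mk ->]; apply: sq; exact: leq_trans mk.
- split=> [_ [n ->]|u uq]; first exact: rle_trans (s0 n) (sq _ _ (leqnn n)).
  apply: small => w [N Nw]; apply: rle_trans (uq _ (ex_intro _ N erefl)) _.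
  by apply: (qP N).2 => _ [k Nk ->]; exact: Nw.
- by rewrite subr0 rabs_id //; exact: sq.
Qed.

(** Trades band projections for excesses: [u = (|f i| - B e)^+] lies below the projection of [|f i|]
    onto its own band. *)
Lemma tuniform_tail {T : E -> E} {e : E} {f : nat -> E} :
  dedekind_complete L -> positive_op L T -> is_linear T -> 0 <=: e ->
  tuniform L T e f ->
  exists (B0 : R) (p : R -> E), [/\ 0 <= B0,
    forall B i, B0 <= B -> (1 <= i)%N ->
      T (pos (abs (f i) - B *: e)) <=: p B &
    forall u, (forall B, B0 <= B -> u <=: p B) -> u <=: 0].
Proof.
move=> DC Tp Tl e0 [c0 [g [gsup [c1 [p [pdec [_ pinf] gp]]]]]].
pose B0 := Num.max 0 (Num.max c0 c1).
exists B0, p; split=> [|B i|u up].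
- by rewrite /B0 le_max lexx.
- rewrite /B0 !ge_max => /andP[B0' /andP[c0B c1B]] i1.
  have [ubg _] := gsup _ c0B.
  set u := pos (abs (f i) - B *: e).
  have [||z zP uz] := @bandproj_exists u (abs (f i)) DC.
  + exact: rpos_ge0.
  + apply: rpos_least (rabs_ge0 _).
    by apply: (rle_lin1 B0' e0); vec R.
  apply: rle_trans (pos_mono Tp Tl _ _ uz) _.
  apply: rle_trans (ubg _ _) _; first by exists i; split=> //; exists z.
  by have := gp _ c1B; rewrite subr0; exact: rle_trans (rabs_ge _).
- apply: pinf => _ [c c1c ->].
  apply: rle_trans (up (Num.max c B0) _) _; first by rewrite le_max lexx orbT.
  by apply: pdec => //; rewrite le_max lexx.
Qed.

(** * Cesaro means of mixingales *)

Lemma nat_ge_mul (a t : R) : 0 < t -> exists N : nat,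
  forall n : nat, (N <= n)%N -> a <= t * n%:R.
Proof.
move=> t0; exists (Num.bound `|a / t|) => n Nn.
rewrite -ler_pdivrMl // mulrC; apply: le_trans (ler_norm _) _.
by apply: le_trans (ltW (archi_boundP (normr_ge0 _))) _; rewrite ler_nat.
Qed.

Lemma avg_le {u v : nat -> E} n :
  (forall i, (1 <= i)%N -> u i <=: v i) -> avg u n <=: avg v n.
Proof.
move=> uv; apply: rle_scale; first by rewrite invr_ge0.
by rewrite !big_add1 /=; apply: rle_sum => i _; apply: uv.
Qed.

(** An inequality, because the average for [n = 0] is [0]. *)
Lemma avg_const_le {x} n : 0 <=: x -> avg (fun=> x) n <=: x.
Proof.
move=> x0; rewrite /avg sumr_const_nat subSS subn0 -scaler_nat scalerA.
case: n => [|n]; first by rewrite mulr0 scale0r.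
by rewrite mulVf ?pnatr_eq0 // scale1r; exact: rle_refl.
Qed.

Lemma avgD (u v : nat -> E) n : avg (fun i => u i + v i) n = avg u n + avg v n.
Proof. by rewrite /avg big_split scalerDr. Qed.

Lemma avgZ a (u : nat -> E) n : avg (fun i => a *: u i) n = a *: avg u n.
Proof. by rewrite /avg -scaler_sumr !scalerA mulrC. Qed.

Lemma avg_sum (I : Type) (s : seq I) (u : I -> nat -> E) n :
  avg (fun i => \sum_(j <- s) u j i) n = \sum_(j <- s) avg (u j) n.
Proof. by rewrite /avg exchange_big scaler_sumr. Qed.

Lemma eq_avg {u v : nat -> E} n :
  (forall i, (1 <= i)%N -> u i = v i) -> avg u n = avg v n.
Proof.
move=> uv; rewrite /avg !big_add1; congr (_ *: _).
by apply: eq_bigr => i _; exact: uv.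
Qed.

Lemma pos_rabs_avg {T : E -> E} (u : nat -> E) n :
  positive_op L T -> is_linear T ->
  T (abs (avg u n)) <=: avg (fun i => T (abs (u i))) n.
Proof.
move=> Tp Tl; have n0 : 0 <= n%:R^-1 :> R by rewrite invr_ge0.
rewrite /avg -(lin_sum Tl) -(linZ Tl); apply: (pos_mono Tp Tl).
apply: rle_trans (rabsZ n0) (rle_scale n0 _); exact: rabs_sum.
Qed.

Lemma pos_rabsD {T : E -> E} x y : positive_op L T -> is_linear T ->
  T (abs (x + y)) <=: T (abs x) + T (abs y).
Proof.
by move=> Tp Tl; rewrite -(linD Tl); apply: (pos_mono Tp Tl); exact: rabsD.
Qed.

Lemma pos_rabs_sum {T : E -> E} {I : Type} (s : seq I) (u : I -> E) :
  positive_op L T -> is_linear T ->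
  T (abs (\sum_(j <- s) u j)) <=: \sum_(j <- s) T (abs (u j)).
Proof.
move=> Tp Tl; rewrite -(lin_sum Tl).
by apply: (pos_mono Tp Tl); exact: rabs_sum.
Qed.

(** Signed, so that [x - excess B e x] is [x] clamped between [- B e] and [B e]. *)
Definition excess (B : R) (e x : E) : E :=
  pos (x - B *: e) - pos (- x - B *: e).

Lemma rabs_excess_le (B : R) e x : abs (excess B e x) <=: pos (abs x - B *: e).
Proof.
have xp : pos (x - B *: e) <=: pos (abs x - B *: e).
  by apply: rpos_mono; apply: rle_add; exact: rabs_ge.
have xn : pos (- x - B *: e) <=: pos (abs x - B *: e).
  by apply: rpos_mono; apply: rle_add; exact: rabs_geN.
apply: rabs_least.
  by apply: (rle2 xp (rpos_ge0 (- x - B *: e))); rewrite /excess; vec R.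
by apply: (rle2 xn (rpos_ge0 (x - B *: e))); rewrite /excess; vec R.
Qed.

Lemma rabs_truncation_le (B : R) e x : 0 <= B -> 0 <=: e ->
  abs (x - excess B e x) <=: B *: e.
Proof.
move=> B0 e0; have Be0 : 0 <=: B *: e.
  by have := rle_scalel e0 B0; rewrite scale0r.
have half (y : E) : y + pos (- y - B *: e) <=: B *: e + pos (y - B *: e).
  suff h : pos (- y - B *: e) <=: B *: e + pos (y - B *: e) - y.
    by apply: (rle1 h); vec R.
  apply: rpos_least; last by apply: (rle1 (rpos_ge (y - B *: e))); vec R.
  have two0 : 0 <= 2 :> R by [].
  by apply: (rle_lin2 two0 ler01 Be0 (rpos_ge0 (y - B *: e))); vec R.
apply: rabs_least; first by apply: (rle1 (half x)); rewrite /excess; vec R.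
have := half (- x); rewrite opprK => h.
by apply: (rle1 h); rewrite /excess; vec R.
Qed.

(** For a fixed lag [s] these form, as [i] varies, a martingale difference sequence for the shifted
    filtration [TT (i + s)]. *)
Definition increment (TT : int -> E -> E) (s : int) (f : nat -> E) (i : nat) :=
  TT (Posz i + s) (f i) - TT (Posz i + s - 1) (f i).

(** * Averages of increments along a filtration *)

Section Mixingale.
Context {T : E -> E} {TT : int -> E -> E} {e : E}.
Hypotheses (e0 : 0 <=: e) (Ta : averaging e T).
Hypothesis TTa : forall i, averaging e (TT i).
Hypothesis TT_le : forall i j, (i <= j)%R ->
  forall x, TT i (TT j x) = TT i x /\ TT j (TT i x) = TT i x.
Hypothesis T_TT : forall i x, T (TT i x) = T x.

Lemma rabs_increment_le s f i :
  abs (increment TT s f i) <=: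
    TT (Posz i + s) (abs (f i)) + TT (Posz i + s - 1) (abs (f i)).
Proof.
have key j : abs (TT j (f i)) <=: TT j (abs (f i)).
  by have [Fp Fl _ _] := TTa j; exact: pos_rabs.
rewrite /increment; apply: rle_trans (rabsD _ _) _.
by rewrite (rabsN (TT _ _)); exact: rleD.
Qed.

Lemma bounded_increment_eventually (s : int) (h : nat -> E) (B t : R) :
  0 <= B -> (forall i, (1 <= i)%N -> abs (h i) <=: B *: e) -> 0 < t ->
  exists N, forall n, (N <= n)%N ->
    T (abs (avg (increment TT s h) n)) <=: t *: e.
Proof.
move=> B0 hB t0; have [Tp Tl _ _] := Ta.
(* Increments are bounded by [2 B e], so the bound for [K + 1] kinks is
   [C / ((K + 1) n) + 4 B / (K + 1)]; [K] and then [N] make each term at most [t / 2]. *)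
have [K K_ge] := nat_ge_mul (8 * B) t t0.
set C := 2 * \sum_(k < K.+1) 2 * (2 * B) * k%:R.
have [N N_ge] := nat_ge_mul (2 * C) t t0.
exists N.+1 => n Nn; have n0 : 0 < n%:R :> R by rewrite ltr0n (leq_trans _ Nn).
have B20 : 0 <= 2 * B by rewrite mulr_ge0.
pose F n := TT (Posz n + s).
have Fincr m i : (1 <= i <= m)%N ->
    F m (increment TT s h i) = increment TT s h i.
  move=> /andP[_ im]; have [_ Fl _ _] := TTa (Posz m + s).
  rewrite /F /increment (linB Fl).
  by rewrite !(TT_le _ _ _ _).2 //; lia.
have bound : K.+1%:R *: T (abs (\sum_(1 <= i < n.+1) increment TT s h i)) <=:
    (C + 2 * n%:R * (2 * B)) *: e.
  apply: (@martingale_bound T F e (2 * B)) => // [m||m|m|m].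
  - exact: TTa.
  - by move=> m x; exact: T_TT.
  - have [_ Fl _ _] := TTa (Posz m + s); rewrite /F (lin_sum Fl).
    by apply: eq_big_nat => i; exact: Fincr.
  - have [_ Fl _ _] := TTa (Posz m + s); rewrite /F /increment (linB Fl).
    have -> : Posz m.+1 + s - 1 = Posz m + s by lia.
    by rewrite (TT_le _ _ _ _).1 ?(TT_le _ _ _ _).1 ?subrr //; lia.
  - apply: rle_trans (rabs_increment_le _ _ _) _.
    have bd j : TT j (abs (h m.+1)) <=: B *: e.
      have [Fp Fl Fe _] := TTa j.
      rewrite -[X in _ *: X]Fe -(linZ Fl).
      by apply: (pos_mono Fp Fl); exact: hB.
    by apply: (rle2 (bd (Posz m.+1 + s)) (bd (Posz m.+1 + s - 1))); vec R.
have k0 : 0 < K.+1%:R :> R by [].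
have kn0 : 0 <= (K.+1%:R * n%:R)^-1 :> R by rewrite invr_ge0 mulr_ge0 // ltW.
have ct : (K.+1%:R * n%:R)^-1 * (C + 2 * n%:R * (2 * B)) <= t.
  rewrite mulrC ler_pdivrMr ?mulr_gt0 //.
  have := K_ge _ (leqnSn K); have := N_ge _ (ltnW Nn).
  have : 1 <= K.+1%:R :> R by rewrite ler1n.
  move: K.+1%:R (n%:R) n0 => k r r0 k1 hC hB'.
  have rB : r * (8 * B) <= r * (t * k) by rewrite ler_pM2l.
  have trk : 0 <= t * r * (k - 1) by rewrite !mulr_ge0 ?subr_ge0 // ltW.
  by lra.
apply: rle_trans (rle_scalel e0 ct).
have ni0 : 0 <= n%:R^-1 :> R by rewrite invr_ge0.
apply: rle_trans (pos_mono Tp Tl _ _ (rabsZ ni0)) _; rewrite (linZ Tl).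
have kN0 : K.+1%:R != 0 :> R by rewrite gt_eqF.
have nN0 : n%:R != 0 :> R by rewrite gt_eqF.
move: (K.+1%:R : R) (n%:R : R) kN0 nN0 kn0 bound => k r kN0 nN0 kn0 bound.
by apply: (rle_lin1 kn0 bound); vec R.
Qed.

(** The clamped part falls under the bounded case; the excess costs [w] for each of the two
    conditional expectations in an increment, as [T] absorbs both. *)
Lemma increment_eventually (s : int) (f : nat -> E) (B t : R) (w : E) :
  0 <= B -> 0 <=: w ->
  (forall i, (1 <= i)%N -> T (pos (abs (f i) - B *: e)) <=: w) -> 0 < t ->
  exists N, forall n, (N <= n)%N ->
    T (abs (avg (increment TT s f) n)) <=: t *: e + 2 *: w.
Proof.
move=> B0 w0 fw t0; have [Tp Tl _ _] := Ta.
pose r i := excess B e (f i); pose h i := f i - r i.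
have hB i : (1 <= i)%N -> abs (h i) <=: B *: e.
  by move=> _; exact: rabs_truncation_le.
have [N N_le] := bounded_increment_eventually s h B t B0 hB t0.
exists N => n /N_le hn.
have -> : avg (increment TT s f) n =
    avg (increment TT s h) n + avg (increment TT s r) n.
  rewrite -avgD; apply: eq_avg => i _; rewrite /increment /h.
  have [_ Fl _ _] := TTa (Posz i + s); have [_ Gl _ _] := TTa (Posz i + s - 1).
  by rewrite (linB Fl) (linB Gl); vec R.
apply: rle_trans (pos_rabsD _ _ Tp Tl) _; apply: (rleD hn).
apply: rle_trans (pos_rabs_avg _ _ Tp Tl) _.
have two0 : 0 <= 2 :> R by [].
have w20 : 0 <=: 2 *: w by have := rle_scale two0 w0; rewrite scaler0.
apply: rle_trans (avg_const_le n w20); apply: avg_le => i i1.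
apply: rle_trans (pos_mono Tp Tl _ _ (rabs_increment_le _ _ _)) _.
rewrite (linD Tl) !T_TT.
have rw : T (abs (r i)) <=: w.
  apply: rle_trans (fw i i1); apply: (pos_mono Tp Tl).
  exact: rabs_excess_le.
by apply: (rle_lin1 two0 rw); vec R.
Qed.

(** The lags run from [1 - m] to [m] and do not depend on [i], so averaging over [i] meets only
    [2 m] difference sequences. *)
Lemma telescoping_decomposition (f : nat -> E) (m i : nat) :
  f i = (f i - TT (Posz i + Posz m) (f i)) + TT (Posz i - Posz m) (f i) +
    \sum_(k < m + m) increment TT (Posz k.+1 - Posz m) f i.
Proof.
pose g k := TT (Posz i - Posz m + Posz k) (f i).
have -> : \sum_(k < m + m) increment TT (Posz k.+1 - Posz m) f i =
    \sum_(0 <= k < m + m) (g k.+1 - g k).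
  rewrite big_mkord; apply: eq_bigr => k _.
  by rewrite /increment /g; congr (TT _ _ - TT _ _); lia.
rewrite telescope_sumr // /g addr0.
have -> : Posz i - Posz m + Posz (m + m) = Posz i + Posz m by lia.
by vec R.
Qed.

Lemma avg_eventually (f c : nat -> E) (Phi : nat -> R) (m : nat) (B t : R)
    (w : E) : (1 <= m)%N -> 0 <= B -> 0 <=: w -> 0 < t ->
  (forall i, (1 <= i)%N ->
    T (abs (TT (Posz i - Posz m) (f i))) <=: Phi m *: c i) ->
  (forall i, (1 <= i)%N ->
    T (abs (f i - TT (Posz i + Posz m) (f i))) <=: Phi m.+1 *: c i) ->
  (forall i, (1 <= i)%N -> T (pos (abs (f i) - B *: e)) <=: w) ->
  exists N, forall n, (N <= n)%N ->
    T (abs (avg f n)) <=: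
      (Phi m.+1 + Phi m) *: avg c n + (m + m)%:R *: (t *: e + 2 *: w).
Proof.
move=> m1 B0 w0 t0 fm fp fw; have [Tp Tl _ _] := Ta.
have [N N_le] : exists N, forall k : 'I_(m + m), forall n, (N <= n)%N ->
    T (abs (avg (increment TT (Posz k.+1 - Posz m) f) n)) <=: t *: e + 2 *: w.
  have /choice[N NP] := fun k : 'I_(m + m) =>
    increment_eventually (Posz k.+1 - Posz m) f B t w B0 w0 fw t0.
  exists (\max_k N k)%N => k n Nn; apply: NP; apply: leq_trans Nn.
  exact: leq_bigmax.
exists N => n Nn.
rewrite (eq_avg _ (fun i _ => telescoping_decomposition f m i)) 2!avgD avg_sum.
rewrite scalerDl -!avgZ.
apply: rle_trans (pos_rabsD _ _ Tp Tl) _; apply: rleD.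
  apply: rle_trans (pos_rabsD _ _ Tp Tl) _.
  by apply: rleD; apply: rle_trans (pos_rabs_avg _ _ Tp Tl) _; apply: avg_le.
apply: rle_trans (pos_rabs_sum _ _ Tp Tl) _.
have -> : (m + m)%:R *: (t *: e + 2 *: w) = \sum_(k < m + m) (t *: e + 2 *: w).
  by rewrite sumr_const card_ord scaler_nat.
by apply: rle_sum => k _; exact: N_le.
Qed.

End Mixingale.

(** * The weak law of large numbers *)

Lemma cond_exp_averaging {e : E} {F : E -> E} :
  cond_exp L F -> F e = e -> averaging e F.
Proof.
move=> [[Fp _ Fl FF _] [Fs _]] Fe; split=> // x y Fx Fy.
by have [z] := Fs x y; rewrite Fx Fy => ->; exact: FF.
Qed.

(** At a fixed level [B], [|f i|] is at most its excess plus [B e]. *)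
Lemma tuniform_mean_bounded {T : E -> E} {e : E} {f : nat -> E} :
  dedekind_complete L -> averaging e T -> 0 <=: e -> tuniform L T e f ->
  exists b : E, forall i, (1 <= i)%N -> T (abs (f i)) <=: b.
Proof.
move=> DC [Tp Tl Te _] e0 fu.
have [B [p [_ fB _]]] := tuniform_tail DC Tp Tl e0 fu.
exists (p B + B *: e) => i i1.
apply: rle_trans (rleD (fB _ _ (lexx B) i1) (rle_refl _ (B *: e))).
rewrite -{2}Te -(linZ Tl) -(linD Tl); apply: (pos_mono Tp Tl).
by apply: (rle1 (rpos_ge (abs (f i) - B *: e))); vec R.
Qed.

(** Limits are taken in a fixed order: [t] determines [m]; then [n] grows, the error [r] of the
    bounded case vanishes, the level [B] grows, and finally [t] tends to [0]. *)
Lemma mixingale_wlln (T : E -> E) (e b : E) (TT : int -> E -> E)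
    (f c : nat -> E) (Phi : nat -> R) :
  dedekind_complete L -> cond_exp L T -> weak_unit L e -> T e = e ->
  filtration L TT -> compatible T TT -> mixingale_with L T TT f c Phi ->
  tuniform L T e f -> (forall n, (1 <= n)%N -> avg c n <=: b) ->
  oconv L (fun n => T (rabs L (avg f n))) 0.
Proof.
move=> DC Tc [e0 _] Te [TTc TT_le] TTT [_ Phi_ge0 Phi0 fm fp] fu cb.
have Ta := cond_exp_averaging Tc Te; have [Tp Tl _ _] := Ta.
have TTa i : averaging e (TT i).
  by apply: cond_exp_averaging (TTc i) _; rewrite -{1}Te (TTT _ _).1.
have T_TT i x : T (TT i x) = T x := (TTT i x).2.
have [B0 [p [B0_ge0 fB pinf]]] := tuniform_tail DC Tp Tl e0 fu.
have p0 B : B0 <= B -> 0 <=: p B.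
  by move=> /fB h; apply: rle_trans (h _ (leqnn 1)); apply: Tp; exact: rpos_ge0.
have [bf fbd] := tuniform_mean_bounded DC Ta e0 fu.
have bd0 : 0 <=: bf.
  by apply: rle_trans (fbd _ (leqnn 1)); apply: Tp; exact: rabs_ge0.
apply: (@oconv0_eventually _ bf) => // [n|n|u small].
- by apply: Tp; exact: rabs_ge0.
- apply: rle_trans (pos_rabs_avg _ _ Tp Tl) _.
  by apply: rle_trans (avg_const_le n bd0); exact: avg_le.
apply: (archimedean DC (rabs_ge0 b)) => t t0.
have t20 : 0 < t / 2 by rewrite divr_gt0.
(* The successor ensures [1 <= m], as the mixingale bounds require. *)
have [M M_le] := Phi0 _ t20; pose m := M.+1.
have Phi_le : Phi m.+1 + Phi m <= t.
  have h1 := M_le m (leqnSn M).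
  have h2 := M_le m.+1 (leqW (leqnSn M)).
  have := ler_norm (Phi m); have := ler_norm (Phi m.+1); lra.
have m0 : 0 <= (m + m)%:R :> R by [].
have uB B : B0 <= B -> u - t *: abs b <=: (2 * (m + m)%:R) *: p B.
  move=> B0B; have B_ge0 := le_trans B0_ge0 B0B.
  suff h : u - t *: abs b - (2 * (m + m)%:R) *: p B <=: 0.
    by apply: (rle1 h); vec R.
  have mme : 0 <=: (m + m)%:R *: e.
    by have := rle_scale m0 e0; rewrite scaler0.
  apply: (archimedean DC mme) => r r0.
  suff h : u <=: t *: abs b + (m + m)%:R *: (r *: e + 2 *: p B).
    by apply: (rle1 h); vec R.
  apply: small.
  have [N N_le] := avg_eventually e0 Ta TTa TT_le T_TT f c Phi m B r (p B)
    (ltn0Sn M) B_ge0 (p0 _ B0B) r0 (fun i i1 => fm i m i1 (ltn0Sn M))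
    (fun i i1 => fp i m i1 (ltn0Sn M)) (fun i => fB B i B0B).
  exists N.+1 => n Nn.
  apply: rle_trans (N_le n (ltnW Nn)) _; apply: rleD _ (rle_refl _ _).
  have n1 : (1 <= n)%N by exact: leq_trans Nn.
  have P0 : 0 <= Phi m.+1 + Phi m by rewrite addr_ge0 ?Phi_ge0.
  (* [|b|] replaces [b] to have a positive element, whose multiples are monotone in the scalar. *)
  apply: rle_trans (rle_scalel (rabs_ge0 b) Phi_le).
  exact: rle_scale P0 (rle_trans (cb n n1) (rabs_ge b)).
set k := 2 * (m + m)%:R in uB.
have k0 : 0 < k by rewrite mulr_gt0 // ltr0n.
have ki0 : 0 <= k^-1 by rewrite invr_ge0 ltW.
have kN0 : k != 0 by rewrite gt_eqF.
have h : k^-1 *: (u - t *: abs b) <=: 0.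
  by apply: pinf => B /uB uBB; apply: (rle_lin1 ki0 uBB); vec R.
by apply: (rle_lin1 (ltW k0) h); vec R.
Qed.

End RieszSpace.

Theorem theorem4p2 (R : realType) (E : lmodType R) (L : riesz E)
  (T : E -> E) (e : E) (TT : int -> E -> E) (f c : nat -> E) (Phi : nat -> R) :
  dedekind_complete L ->
  cond_exp L T ->
  weak_unit L e -> T e = e ->
  filtration L TT -> compatible T TT ->
  mixingale_with L T TT f c Phi ->
  tuniform L T e f ->
  (order_bounded_seq L (avg c) ->
     oconv L (fun n => T (rabs L (avg f n))) 0) /\
  ((forall i, (1 <= i)%N -> c i = T (rabs L (f i))) ->
     oconv L (fun n => T (rabs L (avg f n))) 0).
Proof.
move=> DC Tc eW Te TTf TTT fM fu.
have wlln := mixingale_wlln L T e _ TT f c Phi DC Tc eW Te TTf TTT fM fu.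
split=> [[a [b cb]]|cE].
  by apply: (wlln b) => n n1; exact: (cb n n1).2.
have [e0 _] := eW; have [Tp Tl _ _] := cond_exp_averaging L Tc Te.
(* For (b), uniformity itself bounds the [c i], and hence their averages. *)
have [b fb] := tuniform_mean_bounded L DC (cond_exp_averaging L Tc Te) e0 fu.
have b0 : rle L 0 b.
  by apply: rle_trans (fb _ (leqnn 1)); apply: Tp; exact: rabs_ge0.
apply: (wlln b) => n _; apply: rle_trans (avg_const_le L n b0).
by apply: avg_le => i i1; rewrite cE //; exact: fb.
Qed.
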